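(* Let $I$ be a monomial ideal in a polynomial ring $R$ over a field. Let $\{b_{1,0},b_{1,1}\},\dots,\{b_{s,0},b_{s,1}\}$ be pairwise disjoint sets, each consisting of two distinct variables of $R$, such that for every $1\le i\le s$: (1) no minimal monomial generator of $I$ is divisible by $b_{i,0}^2$ or by $b_{i,1}^2$; (2) every minimal monomial generator of $I$ divisible by $b_{i,0}$ is also divisible by $b_{i,1}$; (3) there do not exist variables $c,d$ of $R$, not necessarily distinct, such that all three of $b_{i,1}c$, $b_{i,1}d$, $cd$ divide minimal monomial generators of $I$. Moreover, suppose that for all $1\le j<r\le s$ there is no minimal monomial generator $M$ of $I$ with $b_{j,1}b_{r,1}\mid M$. Let $f_i=b_{i,0}+b_{i,1}$ for $1\le i\le s$. Then $f_1,\dots,f_s$ is a regular sequence on $R/I^2$, and $\operatorname{depth}(R/I^2)\ge s$.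
   Context: In (3), each of the three products is required to divide some minimal monomial generator of $I$ (possibly different generators for different products). Depth is taken with respect to the homogeneous maximal ideal of $R$. *)

(* Defs.v *)
From HB Require Import structures.
From mathcomp Require Import all_boot all_order all_algebra.
From mathcomp Require Import boolp classical_sets.
From mathcomp Require Import mpoly.

Set Implicit Arguments.
Unset Strict Implicit.
Unset Printing Implicit Defensive.

Import Order.TTheory GRing.Theory.

Local Open Scope classical_set_scope.
Local Open Scope ring_scope.

(* An idealr is a proper ideal: 1 \notin I is part of the structure. *)
Section Ideals.
Context {R : comNzRingType}.

Definition ideal_gen (A : set R) : set R :=
  [set p | exists t : seq (R * R),
     (forall x, x \in t -> A x.2) /\ p = \sum_(x <- t) x.1 * x.2].

Definition ideal_mul (I J : idealr R) : {pred R} :=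
  fun p => `[< ideal_gen [set a * b | a in [set` I] & b in [set` J]] p >].

Lemma ideal_mul_closed (I J : idealr R) : idealr_closed (ideal_mul I J).
Proof.
split.
- apply/asboolP; exists [::]; split=> //; by rewrite big_nil.
- apply/asboolP => -[t [tIJ e]].
  have: 1 \in I; last by rewrite idealr1.
  rewrite e big_seq; apply: rpred_sum => x /tIJ [a aI [b _ <-]].
  by rewrite mulrCA mulrC; exact: idealMr aI.
- move=> a u v /asboolP [t [tIJ ->]] /asboolP [t' [t'IJ ->]].
  apply/asboolP; exists ([seq (a * x.1, x.2) | x <- t] ++ t'); split.
    move=> x; rewrite mem_cat => /orP[/mapP[y yt ->]|]; [exact: tIJ yt|exact: t'IJ].
  rewrite big_cat big_map mulr_sumr /=; congr (_ + _).
  by apply: eq_bigr => x _; rewrite mulrA.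
Qed.

HB.instance Definition _ (I J : idealr R) :=
  isIdealr.Build R (ideal_mul I J) (ideal_mul_closed I J).

End Ideals.

(* The library equips R/I with a ring structure only; this is its canonical
   R-module structure. *)
Section QuotientModule.
Variables (R : comNzRingType) (I : idealr R).
Local Notation Q := {ideal_quot I}.

Definition quot_scale (a : R) (x : Q) : Q := \pi_Q%qT a * x.

Fact quot_scaleA a b x : quot_scale a (quot_scale b x) = quot_scale (a * b) x.
Proof. by rewrite /quot_scale rmorphM mulrA. Qed.
Fact quot_scale1 : left_id 1 quot_scale.
Proof. by move=> x; rewrite /quot_scale rmorph1 mul1r. Qed.
Fact quot_scaleDr : right_distributive quot_scale +%R.
Proof. by move=> a x y; rewrite /quot_scale mulrDr. Qed.
Fact quot_scaleDl x : {morph quot_scale^~ x : a b / a + b}.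
Proof. by move=> a b; rewrite /quot_scale rmorphD mulrDl. Qed.

HB.instance Definition _ := GRing.Zmodule_isLmodule.Build R Q
  quot_scaleA quot_scale1 quot_scaleDr quot_scaleDl.

End QuotientModule.

Section RegularSequences.
Context {R : comNzRingType}.

(* The submodule A M of M generated by the products a *: m, with a in A. *)
Definition submod_gen (A : set R) (M : lmodType R) : set M :=
  [set m | exists t : seq (R * M),
     (forall x, x \in t -> A x.1) /\ m = \sum_(x <- t) x.1 *: x.2].
Arguments submod_gen A M : clear implicits.

(* The first conjunct unfolds "x_i is a nonzerodivisor on
   M / (x_0, ..., x_(i-1)) M"; the second one is "M / (x_0, ...) M != 0". *)
Definition regular_sequence (M : lmodType R) (xs : seq R) : Prop :=
  (forall i, (i < size xs)%N -> forall m : M,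
     submod_gen [set` take i xs] M (xs`_i *: m) ->
     submod_gen [set` take i xs] M m) /\
  exists m : M, ~ submod_gen [set` xs] M m.

(* The maximal length of an M-regular sequence of elements of m. The value None
   stands for +oo: there is no maximal length, or there is no M-regular sequence
   at all (that is, M = 0, as the empty sequence is regular otherwise). *)
Definition depth (m : set R) (M : lmodType R) : option nat :=
  let lengths := [set size xs | xs in
    [set xs | regular_sequence M xs /\ [set` xs] `<=` m]] in
  if pselect (exists d, lengths d /\ forall e, lengths e -> (e <= d)%N) is left h
  then Some (sval (cid h)) else None.

End RegularSequences.

Definition enat_le (s : nat) (d : option nat) : bool :=
  if d is Some e then (s <= e)%N else true.

Section MonomialIdeals.
Context {k : fieldType} {n : nat}.
Implicit Types (I : idealr {mpoly k[n]}) (S G : set 'X_{1..n}).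

Definition generated_by_monomials I S : Prop :=
  [set` I] = ideal_gen [set 'X_[m] | m in S].

Definition monomial_ideal I : Prop := exists S, generated_by_monomials I S.

Definition minimal_monomial_generators I G : Prop :=
  generated_by_monomials I G /\
  forall S, S `<=` G -> generated_by_monomials I S -> S = G.

(* This set G is in fact unique. *)
Definition minimal_monomial_generator I (m : 'X_{1..n}) : Prop :=
  exists2 G, minimal_monomial_generators I G & G m.

Definition homog_max_ideal : set {mpoly k[n]} := ideal_gen (range (fun i => 'X_i)).

End MonomialIdeals.

Arguments homog_max_ideal k n : clear implicits.

(* Main.v *)
Require Import Defs.
From HB Require Import structures.
From mathcomp Require Import all_boot all_order all_algebra.
From mathcomp Require Import boolp classical_sets.
From mathcomp Require Import mpoly zify.

Set Implicit Arguments.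
Unset Strict Implicit.
Unset Printing Implicit Defensive.

Local Open Scope ring_scope.
Import GRing.Theory.
Local Open Scope classical_set_scope.

(** Write f_i for the sum of the i-th pair of variables.  Modulo the f_i with
   i < r, the variable b_{i,0} becomes - b_{i,1}, so R/(I^2, f_0, ..., f_{r-1})
   is governed by the substitution [identify_mpoly], which sends b_{i,0} to
   - b_{i,1} for i < r.  A monomial goes to plus or minus a monomial, hence the
   image of I^2 generates a monomial ideal again, and a polynomial p lies in
   (I^2, f_0, ..., f_{r-1}) exactly when its image lies in that monomial ideal
   ([mem_ideal_square_pairs]).  The substitution fixes f_r, so everything
   reduces to one statement about monomial ideals ([edge_sum_regular]): if a
   set S of monomials is square-free in a variable b, if each of its members
   has at most as many factors a as factors b, and if there are no c, d such
   that bc, bd and cd all divide members of S, then a + b is a nonzerodivisor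
   modulo the ideal J generated by the products of two members of S.

   For that statement, suppose that (a + b) p lies in J while p does not.  Among
   the terms of p outside J that differ only by trading factors a for factors
   b, the one with the most a must satisfy w1 a in J, because no other term of p
   outside J can cancel w1 a in (a + b) p; the one with the most b satisfies
   w2 b in J likewise ([extremal_term]).  The bounds on exponents force w1 and w2
   to be the same monomial w, with exponent 0 in a and 1 in b.  Then w a is
   divisible by some M Q with a and b in M but not in Q, and w b by some M' N'
   with b in both.  As w is not in J, neither Q M' nor Q N' divides w, and a
   variable c where the first divisibility fails together with a variable d where
   the second fails gives the forbidden configuration b c | M', b d | N',
   c d | Q.

   The hypotheses on I are transported along the substitution by observing that
   a generator containing b_{r,1} contains none of the variables of an earlier
   pair, so divisibility by a neighbour of b_{r,1} is not affected by the
   identification ([neighbour_not_identified]). *)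

(** * Ideals and quotients *)

Section IdealClosure.
Context {R : comNzRingType}.
Implicit Types (A K : set R).

Definition is_ideal K : Prop :=
  [/\ K 0, forall a p, K p -> K (a * p) & forall p q, K p -> K q -> K (p + q)].

Lemma is_ideal_gen A : is_ideal (ideal_gen A).
Proof.
split.
- by exists [::]; split=> //; rewrite big_nil.
- move=> a _ [t [tA ->]]; exists [seq (a * x.1, x.2) | x <- t]; split.
    by move=> _ /mapP[x xt ->]; exact: tA xt.
  by rewrite big_map mulr_sumr; apply: eq_bigr => x _; rewrite mulrA.
- move=> _ _ [t [tA ->]] [u [uA ->]]; exists (t ++ u); rewrite big_cat.
  by split=> // x; rewrite mem_cat => /orP[/tA|/uA].
Qed.

Lemma ideal_gen_incl A : A `<=` ideal_gen A.
Proof.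
move=> p Ap; exists [:: (1, p)]; rewrite big_seq1 mul1r.
by split=> // x; rewrite inE => /eqP ->.
Qed.

Lemma ideal_gen_min A K : is_ideal K -> A `<=` K -> ideal_gen A `<=` K.
Proof.
move=> [K0 KM KD] AK _ [t [tA ->]]; rewrite big_seq.
by apply: (big_ind _ K0 KD) => x /tA /AK; exact: KM.
Qed.

(** Turns regularity on the module R/I into membership in ideals of R, where
   substitutions can act. *)
Lemma submod_gen_quotient (I : idealr R) A p :
  submod_gen A (M := {ideal_quot I}) (\pi_{ideal_quot I}%qT p)
  <-> ideal_gen (A `|` [set` I]) p.
Proof.
have [id0 idM idD] := is_ideal_gen (A `|` [set` I]).
split.
  move=> [t [tA e]].
  pose q := \sum_(x <- t) x.1 * repr x.2.
  have pq : p - q \in I.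
    rewrite Quotient.idealrBE; apply/eqP; rewrite e /q rmorph_sum /=.
    apply: eq_bigr => x _; rewrite rmorphM /= reprK; exact: erefl.
  rewrite -(subrK q p); apply: (idD); first by apply: ideal_gen_incl; right.
  rewrite /q big_seq; apply: (big_ind _ id0 idD) => x xt.
  by rewrite mulrC; apply/idM/ideal_gen_incl; left; exact: tA.
move: p; apply: ideal_gen_min; first split.
- by exists [::]; split=> //; rewrite big_nil rmorph0.
- move=> a p [t [tA e]]; exists [seq (x.1, \pi_{ideal_quot I}%qT a * x.2) | x <- t].
  split; first by move=> _ /mapP[x xt ->]; exact: tA xt.
  rewrite rmorphM /= e mulr_sumr big_map; apply: eq_bigr => x _ /=.
  exact: mulrCA.
- move=> p q [t [tA e]] [u [uA e']]; exists (t ++ u); rewrite big_cat rmorphD /= e e'.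
  by split=> // x; rewrite mem_cat => /orP[/tA|/uA].
- move=> p [Ap|Ip].
    exists [:: (p, 1)]; rewrite big_seq1; split; last by rewrite /GRing.scale /= /quot_scale mulr1.
    by move=> x; rewrite inE => /eqP ->.
  exists [::]; split=> //; rewrite big_nil -(rmorph0 (\pi_{ideal_quot I}%qT)).
  by apply/eqP; rewrite -Quotient.idealrBE subr0.
Qed.

End IdealClosure.

(** * Monomial ideals and their squares *)

Section MonomialIdealSupport.
Context {k : fieldType} {n : nat}.
Implicit Types (S : set 'X_{1..n}) (p : {mpoly k[n]}) (I : idealr {mpoly k[n]}).

Definition multiples S : set 'X_{1..n} := [set m | exists2 g, S g & (g <= m)%MM].

Definition mon_ideal S : set {mpoly k[n]} := ideal_gen [set 'X_[m] | m in S].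

Lemma multiples_up S m m' : multiples S m -> (m <= m')%MM -> multiples S m'.
Proof. by move=> [g Sg gm] mm'; exists g => //; exact: lepm_trans gm mm'. Qed.

(** Membership is tested term by term: this is what makes arguments about
   single monomials conclusive. *)
Lemma mem_mon_ideal S p :
  mon_ideal S p <-> forall m, m \in msupp p -> multiples S m.
Proof.
split.
  move: p; apply: ideal_gen_min; first split.
  - by move=> m; rewrite msupp0.
  - move=> a p pS m /msuppM_le /allpairsP[[u v] /= [_ /pS vS ->]].
    exact: multiples_up vS (lem_addl _ _).
  - by move=> p q pS qS m /msuppD_le; rewrite mem_cat => /orP[/pS|/qS].
  - move=> _ [g Sg <-] m; rewrite msuppX inE => /eqP ->.
    by exists g => //; exact: lepm_refl.
have [id0 idM idD] := is_ideal_gen [set ('X_[m] : {mpoly k[n]}) | m in S].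
move=> pS; rewrite /mon_ideal (mpolyE p) big_seq.
apply: (big_ind _ id0 idD) => m /pS [g Sg gm].
rewrite -(submK gm) mpolyXD -mul_mpolyC.
by do 2!apply: (idM); apply: ideal_gen_incl; exists g.
Qed.

Lemma mon_idealX S m : mon_ideal S 'X_[m] <-> multiples S m.
Proof.
rewrite mem_mon_ideal msuppX; split=> [|mS m']; first by apply; rewrite inE.
by rewrite inE => /eqP ->.
Qed.

Definition minimal_monomials I : set 'X_{1..n} :=
  [set m | 'X_[m] \in I /\
     forall m', 'X_[m'] \in I -> (m' <= m)%MM -> m' = m].

(** Divisibility of monomials is well founded on degree, so that every monomial
   of I lies above a minimal one.  Without this existence result, hypotheses
   on all minimal generators would carry no information. *)
Lemma minimal_monomial_generators_exist I :
  monomial_ideal I ->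
  minimal_monomial_generators I (minimal_monomials I).
Proof.
move=> [S IS].
have memI m T : generated_by_monomials I T -> ('X_[m] \in I) <-> multiples T m.
  by move=> IT; rewrite -mon_idealX /mon_ideal -IT.
set G := minimal_monomials I.
have below m : 'X_[m] \in I -> multiples G m.
  have [d] := ubnP (mdeg m); elim: d m => // d IH m le_d Im.
  have [Gm|nGm] := pselect (G m); first by exists m => //; exact: lepm_refl.
  have [m' [Im' le_m' ne_m']] : exists m', [/\ 'X_[m'] \in I, (m' <= m)%MM & m' <> m].
    apply: contrapT => nex; apply: nGm; split=> // m' Im' le_m'.
    by apply: contrapT => ne; apply: nex; exists m'.
  apply: multiples_up (le_m'); apply: IH Im'.
  have : (m - m')%MM != 0%MM.
    by apply/eqP=> e; move: (submK le_m'); rewrite e add0m.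
  rewrite -mdeg_eq0; have := mdegD (m - m') m'; rewrite (submK le_m'); lia.
have IG : generated_by_monomials I G.
  rewrite /generated_by_monomials IS; apply/seteqP; split.
    apply: ideal_gen_min; first exact: is_ideal_gen.
    move=> _ [m Sm <-]; apply/mon_idealX; apply: below.
    by apply/(memI _ _ IS); exists m => //; exact: lepm_refl.
  apply: ideal_gen_min; first exact: is_ideal_gen.
  by move=> _ [m [Im _] <-]; apply/mon_idealX/(memI _ _ IS).
split=> // T TG IT; apply/seteqP; split=> // m Gm.
have [t Tt tm] : multiples T m by apply/(memI _ _ IT); case: Gm.
by rewrite -((Gm.2) t) //; case: (TG _ Tt).
Qed.

Definition sums S : set 'X_{1..n} := [set (M + N)%MM | M in S & N in S].

Lemma mem_ideal_square I S p :
  generated_by_monomials I S -> p \in ideal_mul I I <-> mon_ideal (sums S) p.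
Proof.
move=> IS; have memI q : q \in I <-> mon_ideal S q by rewrite /mon_ideal -IS.
have -> : (p \in ideal_mul I I) <->
    ideal_gen [set a * b | a in [set` I] & b in [set` I]] p.
  by rewrite unfold_in; split=> [/asboolP|?]; last apply/asboolP.
split; move: p; apply: ideal_gen_min; try exact: is_ideal_gen.
  move=> _ [a /memI/mem_mon_ideal aS [b /memI/mem_mon_ideal bS <-]].
  apply/mem_mon_ideal => m /msuppM_le /allpairsP[[u v] /= [/aS[M SM Mu] /bS[N SN Nv] ->]].
  exists (M + N)%MM; first by exists M => //; exists N.
  apply/mnm_lepP => i; rewrite !mnmDE; by apply: leq_add; move: i; apply/mnm_lepP.
move=> _ [_ [M SM [N SN <-]] <-]; apply: ideal_gen_incl; rewrite mpolyXD.
by exists 'X_[M]; [|exists 'X_[N] => //]; apply/memI/ideal_gen_incl;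
  [exists M | exists N].
Qed.

End MonomialIdealSupport.

(** * The sum of two variables modulo a monomial ideal *)

(** Terms of a polynomial that can interfere when it is multiplied by the sum
   of the variables a and b. *)
Definition same_line (n : nat) (a b : 'I_n) (v w : 'X_{1..n}) : Prop :=
  (v a + v b = w a + w b)%N /\ forall i, i != a -> i != b -> v i = w i.

Lemma seq_max_exists (T : choiceType) (t : seq T) (f : T -> nat) (x0 : T) :
  x0 \in t -> exists2 x, x \in t & forall y, y \in t -> (f y <= f x)%N.
Proof.
move=> x0t; have [x xt xmax] := @arg_maxnP _ (SeqSub x0t) predT (f \o val) isT.
by exists (val x) => [|y yt]; [exact: valP | exact: (xmax (SeqSub yt))].
Qed.

(** On a line of terms, multiplication by X_a + X_b behaves like multiplication
   of a univariate polynomial by 1 + t: the extreme term survives.  Cancellation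
   against a term that lies in the ideal does no harm, as the product then lies
   in the ideal anyway. *)
Lemma extremal_term (k : fieldType) (n : nat) (a b : 'I_n) (p : {mpoly k[n]})
    (S : set 'X_{1..n}) (w0 : 'X_{1..n}) :
  a != b -> mon_ideal S (('X_a + 'X_b) * p) ->
  w0 \in msupp p -> ~ multiples S w0 ->
  exists w, [/\ same_line a b w0 w, w \in msupp p, ~ multiples S w,
    multiples S (w + U_(a))%MM
    & forall v, same_line a b w0 v -> v \in msupp p -> ~ multiples S v ->
        (v a <= w a)%N].
Proof.
move=> ab /mem_mon_ideal fpS w0p w0S.
pose t := [seq v <- msupp p | `[< same_line a b w0 v /\ ~ multiples S v >]].
have w0t : w0 \in t by rewrite mem_filter w0p andbT; apply/asboolP.
have [w] := seq_max_exists (fun v : 'X_{1..n} => v a) w0t.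
rewrite mem_filter => /andP[/asboolP[w0w wS] wp] wmax.
have {}wmax v : same_line a b w0 v -> v \in msupp p -> ~ multiples S v -> (v a <= w a)%N.
  by move=> w0v vp vS; apply: wmax; rewrite mem_filter vp andbT; apply/asboolP.
exists w; split=> //; apply: contrapT => waS.
(* The coefficient of w + U_(a) in (X_a + X_b) p is zero, so the nonzero
   contribution of w must be cancelled through X_b. *)
have : ('X_b * p)@_(w + U_(a)) != 0.
  have : (('X_a + 'X_b) * p)@_(w + U_(a)) == 0.
    by rewrite mcoeff_eq0; apply/negP => /fpS.
  rewrite mulrDl mcoeffD mulrC addmC mcoeffMX => /eqP e.
  apply/eqP => e'; move: wp; rewrite mcoeff_msupp.
  by move: e; rewrite e' addr0 => ->; rewrite eqxx.
rewrite -mcoeff_msupp mulrC (perm_mem (msuppMX _ _)) => /mapP[v vp e].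
have e_at i := congr1 (fun m : 'X_{1..n} => m i) e.
have [va vb vi] : [/\ v a = (w a).+1, w b = (v b).+1
    & forall i, i != a -> i != b -> v i = w i].
  split=> [||i ia ib]; [move: (e_at a) | move: (e_at b) | move: (e_at i)];
    rewrite /= !mnmDE !mnm1E ?eqxx ?(eq_sym b) ?(eq_sym _ i).
  - by rewrite (negbTE ab); lia.
  - by rewrite (negbTE ab); lia.
  - by rewrite (negbTE ia) (negbTE ib); lia.
have w0v : same_line a b w0 v.
  case: w0w => s0 s1; split=> [|i ia ib]; last by rewrite s1 // vi.
  by rewrite s0 va vb; lia.
suff vS : ~ multiples S v by have := wmax v w0v vp vS; rewrite va ltnn.
move=> vS; apply: waS; rewrite e; apply: multiples_up vS _; exact: lem_addl.
Qed.

Lemma lem_U2 (n : nat) (c d : 'I_n) (M : 'X_{1..n}) :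
  (0 < M c)%N -> (0 < M d)%N -> (c = d -> 1 < M c)%N -> (U_(c) + U_(d) <= M)%MM.
Proof.
move=> Mc Md Mcd; apply/mnm_lepP => i; rewrite mnmDE !mnm1E.
case: eqP => [<-|_]; case: eqP => [e|_] //=; last by rewrite -e.
by rewrite Mcd.
Qed.

(** A divisor of w X_a that does not divide w uses every factor a available. *)
Lemma lem_add1_exact (n : nat) (a : 'I_n) (m w : 'X_{1..n}) :
  (m <= w + U_(a))%MM -> ~ (m <= w)%MM -> m a = (w a).+1.
Proof.
move=> /mnm_lepP le_m nle; have := le_m a; rewrite mnmDE mnm1E eqxx addn1.
rewrite leq_eqVlt => /orP[/eqP // | lt_m]; case: nle; apply/mnm_lepP => i.
have := le_m i; rewrite mnmDE mnm1E; case: eqP => [<- _|]; last by rewrite addn0.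
by rewrite -ltnS.
Qed.

(** The core of the argument: the two extremal terms of a line coincide, and the
   two factorizations found above it can be recombined unless the excluded
   triangle is present. *)
Lemma edge_sum_regular (k : fieldType) (n : nat) (a b : 'I_n)
    (S : set 'X_{1..n}) :
  a != b ->
  (forall M, S M -> (M b <= 1)%N /\ (M a <= M b)%N) ->
  (forall c d M N P, S M -> S N -> S P -> (U_(b) + U_(c) <= M)%MM ->
     (U_(b) + U_(d) <= N)%MM -> (U_(c) + U_(d) <= P)%MM -> False) ->
  forall p : {mpoly k[n]},
    mon_ideal (sums S) (('X_a + 'X_b) * p) -> mon_ideal (sums S) p.
Proof.
move=> ab Sab Stri p fpJ; apply/mem_mon_ideal => w0 w0p; apply: contrapT => w0J.
have [w1 [l1 w1p w1J w1aJ _]] := extremal_term ab fpJ w0p w0J.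
move: fpJ; rewrite addrC => fpJ; rewrite eq_sym in ab.
have [w2 [l2 _ w2J w2bJ w2max]] := extremal_term ab fpJ w0p w0J.
have ba_sym v w : same_line b a v w <-> same_line a b v w.
  by split=> -[e h]; (split=> [|i ? ?]; [lia | exact: h]).
have {w2max} w12 : (w1 b <= w2 b)%N by apply: w2max => //; apply/ba_sym.
case: w1aJ => _ [M SM [N SN <-]] le_a.
case: w2bJ => _ [M' SM' [N' SN' <-]] le_b.
have nle w M1 N1 : S M1 -> S N1 -> ~ multiples (sums S) w -> ~ (M1 + N1 <= w)%MM.
  by move=> SM1 SN1 wJ le1; apply: wJ; exists (M1 + N1)%MM => //; exists M1 => //; exists N1.
have ea := lem_add1_exact le_a (nle _ _ _ SM SN w1J).
have eb := lem_add1_exact le_b (nle _ _ _ SM' SN' w2J).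
have [[Mb Mab] [Nb Nab]] := (Sab _ SM, Sab _ SN).
have [[M'b M'ab] [N'b N'ab]] := (Sab _ SM', Sab _ SN').
have le_ab : (M b + N b <= w1 b)%N.
  by move/mnm_lepP: (le_a) => /(_ b); rewrite !mnmDE mnm1E eq_sym (negbTE ab) addn0.
rewrite mnmDE in ea; rewrite mnmDE in eb.
have [s1 h1] := l1; have [s2 h2] := l2.
have e12 : w2 = w1.
  apply/mnmP => i; have [->|ib] := eqVneq i b; first by lia.
  have [->|ia] := eqVneq i a; first by lia.
  by rewrite -h1 // -h2.
rewrite {}e12 in w2J le_b l2 w12 eb s2 h2.
have [w1a w1b] : (w1 a = 0 /\ w1 b = 1)%N by lia.
(* Exactly one of M, N contains a, hence b; as w1 b = 1, the other one, Q,
   contains neither. *)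
have {ea Mb Mab Nb Nab le_ab}[Q [SQ Qa Qb Qw]] :
    exists Q, [/\ S Q, Q a = 0%N, Q b = 0%N & forall i, i != a -> (Q i <= w1 i)%N].
  have le_i i : i != a -> (M i + N i <= w1 i)%N.
    move=> ia; move/mnm_lepP: (le_a) => /(_ i).
    by rewrite !mnmDE mnm1E eq_sym (negbTE ia) addn0.
  have [Na|Na] := eqVneq (N a) 0%N.
    by exists N; split=> //; [lia | move=> i /le_i; lia].
  by exists M; split=> //; [lia | lia | move=> i /le_i; lia].
have le_i i : i != b -> (M' i + N' i <= w1 i)%N.
  move=> ib; move/mnm_lepP: (le_b) => /(_ i).
  by rewrite !mnmDE mnm1E eq_sym (negbTE ib) addn0.
have le_aa : (M' a + N' a <= w1 a)%N by apply: le_i; rewrite eq_sym.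
have [M'b1 N'b1] : (M' b = 1 /\ N' b = 1)%N by clear -eb w1b M'b N'b; lia.
have [M'a0 N'a0] : (M' a = 0 /\ N' a = 0)%N by clear -le_aa w1a; lia.
(* Q + L cannot divide w1, and the exponents in a and b are small enough, so
   the obstruction sits at a third variable. *)
have clash L : S L -> L a = 0%N -> L b = 1%N ->
    exists c, [/\ c != a, c != b & (w1 c < Q c + L c)%N].
  move=> SL La Lb; apply: contrapT => nex; apply: (nle _ _ _ SQ SL w1J).
  apply/mnm_lepP => i; rewrite mnmDE leqNgt; apply/negP => lt_i; apply: nex.
  exists i; split=> //; apply/eqP => e; move: lt_i; rewrite e; lia.
have [c [ca cb ltc]] := clash _ SM' M'a0 M'b1.
have [d [da db ltd]] := clash _ SN' N'a0 N'b1.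
have := (Qw _ ca, Qw _ da, le_i _ cb, le_i _ db) => -[[[Qc Qd] ec] ed].
have M'c : (0 < M' c)%N by clear -ltc Qc; lia.
have N'd : (0 < N' d)%N by clear -ltd Qd; lia.
apply: (Stri c d M' N' Q SM' SN' SQ); apply: lem_U2.
- by rewrite M'b1.
- exact: M'c.
- by move=> e; rewrite e eqxx in cb.
- by rewrite N'b1.
- exact: N'd.
- by move=> e; rewrite e eqxx in db.
- by clear -ltc ec; lia.
- by clear -ltd ed; lia.
- by move=> e; clear -ltd ec M'c e; subst d; lia.
Qed.

(** * Identifying the variables of the first pairs *)

Section Identification.
Context {k : fieldType} {n s : nat} (b0 b1 : 'I_s -> 'I_n).
Implicit Types (i j : 'I_s) (x y : 'I_n) (M N : 'X_{1..n}) (p q : {mpoly k[n]}).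
Hypothesis b01 : forall i j, b0 i != b1 j.
Hypothesis b0_inj : injective b0.
Variable r : nat.

Definition identify x : 'I_n :=
  if [pick i : 'I_s | (i < r)%N && (b0 i == x)] is Some i then b1 i else x.

Definition identify_mnm M : 'X_{1..n} := (\sum_(x < n) U_(identify x) *+ M x)%MM.

(** The pairs are disjoint, so x is moved exactly when it is some b0 i with
   i < r, and then it is replaced by - b1 i. *)
Definition identify_sign x : k := (-1) ^+ (identify x != x).

Definition identify_mpoly : {mpoly k[n]} -> {mpoly k[n]} :=
  comp_mpoly [tuple identify_sign x *: 'X_(identify x) | x < n].

HB.instance Definition _ := GRing.RMorphism.on identify_mpoly.

Lemma identify_b0 i : (i < r)%N -> identify (b0 i) = b1 i.
Proof.
move=> ir; rewrite /identify; case: pickP => [j /andP[_ /eqP/b0_inj ->] //|/(_ i)].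
by rewrite ir eqxx.
Qed.

Lemma identifyP x :
  identify x = x \/ exists2 i : 'I_s, (i < r)%N & x = b0 i /\ identify x = b1 i.
Proof.
rewrite /identify; case: pickP => [i /andP[ir /eqP e]|_]; last by left.
by right; exists i.
Qed.

Lemma identify_id x : (forall i, (i < r)%N -> x != b0 i) -> identify x = x.
Proof. by move=> xb; case: (identifyP x) => // -[i /xb/eqP nx [/nx]]. Qed.

Lemma identify_mnmE M y :
  identify_mnm M y = (\sum_(x < n | identify x == y) M x)%N.
Proof.
rewrite mnm_sumE [RHS]big_mkcond; apply: eq_bigr => x _.
by rewrite mulmnE mnm1E; case: eqP => _; rewrite ?mul1n.
Qed.

Lemma identify_mnmD M N :
  identify_mnm (M + N) = (identify_mnm M + identify_mnm N)%MM.
Proof.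
apply/mnmP => y; rewrite mnmDE !identify_mnmE -big_split.
by apply: eq_bigr => x _; rewrite mnmDE.
Qed.

Lemma identify_mnm_ge M x : (M x <= identify_mnm M (identify x))%N.
Proof. by rewrite identify_mnmE (bigD1 x) //= leq_addr. Qed.

Lemma identify_mnm_gt0 M y :
  (0 < identify_mnm M y)%N -> exists2 x, identify x = y & (0 < M x)%N.
Proof.
rewrite identify_mnmE lt0n sum_nat_eq0 negb_forall => /existsP[x].
by rewrite negb_imply -lt0n => /andP[/eqP ? ?]; exists x.
Qed.

(** Only the variables b1 i receive new factors. *)
Lemma identify_mnm_le M y :
  (forall i, (i < r)%N -> y != b1 i) -> (identify_mnm M y <= M y)%N.
Proof.
move=> yb; rewrite identify_mnmE big_mkcond (bigD1 y) //= big1 ?addn0.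
  by case: ifP.
move=> x xy; case: eqP => // e; case: (identifyP x) => [e'|[i ir [_ e']]].
  by rewrite -e e' eqxx in xy.
by have := yb i ir; rewrite -e e' eqxx.
Qed.

Lemma identify_mnm_fixed M y :
  (forall i, (i < r)%N -> y != b0 i /\ y != b1 i) -> identify_mnm M y = M y.
Proof.
move=> yb; apply/eqP; rewrite eqn_leq identify_mnm_le => [|i /yb[]//].
by have := identify_mnm_ge M y; rewrite identify_id // => i /yb[].
Qed.

Lemma identify_mpolyU x :
  identify_mpoly 'X_x = identify_sign x *: 'X_(identify x).
Proof. by rewrite /identify_mpoly comp_mpolyXU -tnth_nth tnth_mktuple. Qed.

Lemma identify_mpolyX M :
  exists e : nat, identify_mpoly 'X_[M] = (-1) ^+ e *: 'X_[identify_mnm M].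
Proof.
exists (\sum_(x < n) (identify x != x) * M x)%N.
rewrite /identify_mpoly comp_mpolyX /identify_mnm -prodrXr -mprodXE -scaler_prod.
by apply: eq_bigr => x _; rewrite tnth_mktuple exprZn mpolyXn exprM.
Qed.

Lemma identify_pair i : (i < r)%N -> identify_mpoly ('X_(b0 i) + 'X_(b1 i)) = 0.
Proof.
move=> ir; rewrite rmorphD /= !identify_mpolyU /identify_sign identify_b0 //.
rewrite (eq_sym (b1 i)) b01 identify_id; last by move=> j _; rewrite eq_sym b01.
by rewrite eqxx scaleN1r scale1r addNr.
Qed.

(** The substitution and the identity are ring morphisms that agree modulo K on
   every variable, hence everywhere. *)
Lemma sub_identify_mpoly (K : set {mpoly k[n]}) :
  is_ideal K -> (forall i, (i < r)%N -> K ('X_(b0 i) + 'X_(b1 i))) ->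
  forall p, K (p - identify_mpoly p).
Proof.
move=> [K0 KM KD] Kf.
have K1 : K (1 - identify_mpoly 1) by rewrite rmorph1 subrr.
have KMul p q : K (p - identify_mpoly p) -> K (q - identify_mpoly q) ->
    K (p * q - identify_mpoly (p * q)).
  move=> Kp Kq; rewrite rmorphM /=.
  have -> : p * q - identify_mpoly p * identify_mpoly q =
      q * (p - identify_mpoly p) + identify_mpoly p * (q - identify_mpoly q).
    by rewrite !mulrBr [q * p]mulrC [q * _]mulrC addrA subrK.
  by apply: KD; exact: KM.
have KX x : K ('X_x - identify_mpoly 'X_x).
  rewrite identify_mpolyU /identify_sign.
  have [->|[i ir [-> ->]]] := identifyP x; first by rewrite eqxx scale1r subrr.
  by rewrite (eq_sym (b1 i)) b01 scaleN1r opprK; exact: Kf.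
elim/mpolyind => [|c m p _ _ Kp]; first by rewrite rmorph0 subrr.
have -> : c *: 'X_[m] + p - identify_mpoly (c *: 'X_[m] + p) =
    c%:MP * ('X_[m] - identify_mpoly 'X_[m]) + (p - identify_mpoly p).
  rewrite mul_mpolyC rmorphD /= /identify_mpoly comp_mpolyZ scalerBr opprD.
  by rewrite addrACA.
apply: KD => //; apply: KM; rewrite mpolyXE_id.
apply: (big_ind (fun q => K (q - identify_mpoly q)) K1 KMul) => x _.
by elim: (m x) => [|e IH]; [rewrite expr0 | rewrite exprS; exact: KMul].
Qed.

(** The quotient by I^2 and the first r sums is again a quotient by a monomial
   ideal.  The substitution maps the left ideal into the right one; conversely
   each generator on the right is, up to sign, the image of an element of I^2
   and hence congruent to it modulo the sums. *)
Lemma mem_ideal_square_pairs (I : idealr {mpoly k[n]}) (S : set 'X_{1..n}) p :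
  generated_by_monomials I S ->
  ideal_gen ([set 'X_(b0 i) + 'X_(b1 i) | i in [set i : 'I_s | (i < r)%N]]
             `|` [set` ideal_mul I I]) p
  <-> mon_ideal (sums [set identify_mnm M | M in S]) (identify_mpoly p).
Proof.
move=> IS; set F := [set _ | i in _]; set J := mon_ideal _.
have [J0 JM JD] : is_ideal J := is_ideal_gen _.
have idK := is_ideal_gen (F `|` [set` ideal_mul I I]).
set K := ideal_gen _ in idK *; have [K0 KM KD] := idK.
have signed_mul e (q : {mpoly k[n]}) : (-1) ^+ e *: q = ((-1) ^+ e)%:MP * q.
  by rewrite mul_mpolyC.
split.
  move: p; apply: ideal_gen_min; first split.
  - by rewrite rmorph0.
  - by move=> a p Jp; rewrite rmorphM; exact: JM.
  - by move=> p q Jp Jq; rewrite rmorphD; exact: JD.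
  - move=> p [[i ir <-]|]; first by rewrite identify_pair.
    rewrite /= (mem_ideal_square _ IS); move: p; apply: ideal_gen_min; first split.
    + by rewrite rmorph0.
    + by move=> a p Jp; rewrite rmorphM; exact: JM.
    + by move=> p q Jp Jq; rewrite rmorphD; exact: JD.
    + move=> _ [_ [M SM [N SN <-]] <-] /=.
      have [e ->] := identify_mpolyX (M + N); rewrite signed_mul identify_mnmD.
      apply: JM; apply: ideal_gen_incl; eexists; last by [].
      by exists (identify_mnm M); [exists M | exists (identify_mnm N) => //; exists N].
have Kdiff q : K (q - identify_mpoly q).
  apply: sub_identify_mpoly => // i ir; apply: ideal_gen_incl; left; by exists i.
move=> Jp; rewrite -(subrK (identify_mpoly p) p); apply: (KD); first exact: Kdiff.
move: Jp; move: (identify_mpoly p); apply: ideal_gen_min => // _ [_ [_ [M SM <-] [_ [N SN <-] <-]] <-].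
have [e eX] := identify_mpolyX (M + N).
have -> : 'X_[identify_mnm M + identify_mnm N] =
    ((-1) ^+ e)%:MP * ('X_[M + N] + (- 1) * ('X_[M + N] - identify_mpoly 'X_[M + N])).
  rewrite mulN1r opprB addrC subrK eX mul_mpolyC scalerA -expr2 sqrr_sign scale1r.
  by rewrite identify_mnmD.
apply: (KM); apply: KD; last by apply: KM; exact: Kdiff.
apply: ideal_gen_incl; right; apply/(mem_ideal_square _ IS)/mon_idealX.
by exists (M + N)%MM; [exists M => //; exists N | exact: lepm_refl].
Qed.

End Identification.

(** * Regularity of the sums of pairs *)

Section PairedGenerators.
Context {n s : nat} (b0 b1 : 'I_s -> 'I_n) (S : set 'X_{1..n}).
Implicit Types (i j r : 'I_s) (c d : 'I_n) (M N P : 'X_{1..n}).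
Hypothesis b01 : forall i j, b0 i != b1 j.
Hypothesis b0_inj : injective b0.
Hypothesis b1_inj : injective b1.
Hypothesis b1_sqfree : forall i M, S M -> (M (b1 i) <= 1)%N.
Hypothesis b0_le_b1 : forall i M, S M -> (M (b0 i) <= M (b1 i))%N.
Hypothesis b1_no_triangle : forall i c d M N P, S M -> S N -> S P ->
  (U_(b1 i) + U_(c) <= M)%MM -> (U_(b1 i) + U_(d) <= N)%MM ->
  (U_(c) + U_(d) <= P)%MM -> False.
Hypothesis b1_apart : forall i j M, (i < j)%N -> S M ->
  (U_(b1 i) + U_(b1 j) <= M)%MM -> False.

Lemma lem_U2_identify r c d M :
  (forall i, (i < r)%N -> c != b1 i) -> (forall i, (i < r)%N -> d != b1 i) ->
  (U_(c) + U_(d) <= identify_mnm b0 b1 r M)%MM -> (U_(c) + U_(d) <= M)%MM.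
Proof.
move=> cb db /mnm_lepP le_cd; apply/mnm_lepP => y; have := le_cd y.
rewrite mnmDE !mnm1E.
have [<- le_c|_] := eqVneq c y; first by apply: leq_trans le_c _; exact: identify_mnm_le.
have [<- le_d|//] := eqVneq d y; by apply: leq_trans le_d _; exact: identify_mnm_le.
Qed.

(** If c were b1 i for an earlier pair i, then M would contain b1 i, possibly
   because it contains b0 i, together with b1 r, and the generators keep these
   two apart. *)
Lemma neighbour_not_identified r c M :
  S M -> (U_(b1 r) + U_(c) <= identify_mnm b0 b1 r M)%MM ->
  forall i, (i < r)%N -> c != b1 i.
Proof.
move=> SM /mnm_lepP le_c i ir; apply/eqP => ec; subst c.
have ne_ir : i != r by apply: contraTneq ir => ->; rewrite ltnn.
have ne_b1 : b1 i != b1 r by rewrite (inj_eq b1_inj).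
have Mr : (0 < M (b1 r))%N.
  have := le_c (b1 r); rewrite mnmDE !mnm1E eqxx (negbTE ne_b1) addn0.
  rewrite identify_mnm_fixed // => j jr; rewrite eq_sym b01; split=> //.
  by rewrite (inj_eq b1_inj); apply: contraTneq jr => ->; rewrite ltnn.
have [x ex Mx] : exists2 x, identify b0 b1 r x = b1 i & (0 < M x)%N.
  apply: identify_mnm_gt0.
  by have := le_c (b1 i); rewrite mnmDE !mnm1E eqxx (eq_sym (b1 r)) (negbTE ne_b1).
have Mi : (0 < M (b1 i))%N.
  have [e|[j _ [e e']]] := identifyP b0 b1 r x; first by rewrite -ex e.
  have /b1_inj ij : b1 j = b1 i by rewrite -e' ex.
  by apply: leq_trans (b0_le_b1 i SM); rewrite -ij -e.
apply: (b1_apart ir SM); apply: lem_U2 => // e.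
by rewrite e eqxx in ne_b1.
Qed.

(** The hypotheses of [edge_sum_regular] survive the identification of the pairs
   before r: exponents at b0 r and b1 r do not change, and a triangle at b1 r
   after the identification was one before it. *)
Lemma pair_sum_regular (k : fieldType) r (p : {mpoly k[n]}) :
  let J := mon_ideal (sums [set identify_mnm b0 b1 r M | M in S]) in
  J (('X_(b0 r) + 'X_(b1 r)) * p) -> J p.
Proof.
have fix0 M : identify_mnm b0 b1 r M (b0 r) = M (b0 r).
  apply: identify_mnm_fixed => // i ir; split=> //.
  by rewrite (inj_eq b0_inj); apply: contraTneq ir => ->; rewrite ltnn.
have fix1 M : identify_mnm b0 b1 r M (b1 r) = M (b1 r).
  apply: identify_mnm_fixed => // i ir; rewrite eq_sym b01; split=> //.
  by rewrite (inj_eq b1_inj); apply: contraTneq ir => ->; rewrite ltnn.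
have r_fixed i : (i < r)%N -> b1 r != b1 i.
  by rewrite (inj_eq b1_inj); apply: contraTneq => ->; rewrite ltnn.
apply: edge_sum_regular => [//|_ [M SM <-]|c d _ _ _ [M SM <-] [N SN <-] [P SP <-]].
  by rewrite fix0 fix1 b1_sqfree ?b0_le_b1.
move=> Mc Nd Pcd.
have cb := neighbour_not_identified SM Mc; have db := neighbour_not_identified SN Nd.
by apply: (@b1_no_triangle r c d M N P) => //; apply: lem_U2_identify; eauto.
Qed.

End PairedGenerators.

Lemma enat_le_depth (R : comNzRingType) (m : set R) (M : lmodType R) (xs : seq R) :
  regular_sequence M xs -> [set` xs] `<=` m -> enat_le (size xs) (depth m M).
Proof.
move=> xs_reg xs_m; rewrite /depth; case: pselect => //= h.
by case: cid => d [_ d_max] /=; apply: d_max; exists xs.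
Qed.

Lemma take_map_enum (R : eqType) (s r : nat) (f : 'I_s -> R) :
  [set` take r [seq f i | i <- enum 'I_s]] = [set f i | i in [set i : 'I_s | (i < r)%N]].
Proof.
rewrite -map_take; apply/seteqP; split=> x /=.
  move=> /mapP[i + ->]; rewrite in_take ?mem_enum // index_enum_ord => ir.
  by exists i.
move=> [i ir <-]; apply: map_f.
by rewrite in_take ?mem_enum // index_enum_ord.
Qed.

Local Close Scope classical_set_scope.

Theorem theorem3p7 (k : fieldType) (n : nat) (I : idealr {mpoly k[n]})
    (s : nat) (b0 b1 : 'I_s -> 'I_n) :
  monomial_ideal I ->
  (forall i, b0 i != b1 i) ->
  (forall i j, i != j ->
     [disjoint [set b0 i; b1 i]%SET & [set b0 j; b1 j]%SET]) ->
  (forall i M, minimal_monomial_generator I M ->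
     ~~ (U_(b0 i) *+ 2 <= M)%MM /\ ~~ (U_(b1 i) *+ 2 <= M)%MM) ->
  (forall i M, minimal_monomial_generator I M ->
     (U_(b0 i) <= M)%MM -> (U_(b1 i) <= M)%MM) ->
  (forall i, ~ exists c d : 'I_n,
     [/\ exists2 M, minimal_monomial_generator I M &
           (U_(b1 i) + U_(c) <= M)%MM,
         exists2 M, minimal_monomial_generator I M &
           (U_(b1 i) + U_(d) <= M)%MM &
         exists2 M, minimal_monomial_generator I M &
           (U_(c) + U_(d) <= M)%MM]) ->
  (forall j r : 'I_s, (j < r)%N ->
     ~ exists2 M, minimal_monomial_generator I M &
         (U_(b1 j) + U_(b1 r) <= M)%MM) ->
  regular_sequence {ideal_quot (ideal_mul I I)}
    [seq 'X_(b0 i) + 'X_(b1 i) | i <- enum 'I_s] /\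
  enat_le s (depth (homog_max_ideal k n) {ideal_quot (ideal_mul I I)}).
Proof.
move=> Imon b_ne b_disj b_sqfree b_dvd b_tri b_apart.
have Gmin := minimal_monomial_generators_exist Imon.
set G := minimal_monomials I in Gmin; have IG := Gmin.1.
have genG M : G M -> minimal_monomial_generator I M by exists G.
have b_sep i j x : (x == b0 i) || (x == b1 i) -> (x == b0 j) || (x == b1 j) -> i = j.
  move=> xi xj; have [//|ij] := eqVneq i j.
  by have := disjointFr (b_disj i j ij) (x := x); rewrite !finset.inE xi xj => /(_ isT).
have b0_inj : injective b0.
  by move=> i j e; apply: (b_sep i j (b0 i)); rewrite ?e eqxx.
have b1_inj : injective b1.
  by move=> i j e; apply: (b_sep i j (b1 i)); rewrite ?e eqxx orbT.
have b01 i j : b0 i != b1 j.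
  apply/eqP => e; have ij : i = j.
    by apply: (b_sep i j (b0 i)); rewrite ?e eqxx ?orbT.
  by move: (b_ne i); rewrite e ij eqxx.
have sqfree (x : 'I_n) M : ~~ (U_(x) *+ 2 <= M)%MM -> (M x <= 1)%N.
  apply: contraR; rewrite -ltnNge => Mx; apply/mnm_lepP => y.
  by rewrite mulmnE mnm1E; case: eqP => [<-|].
have b1_sqfree i M : G M -> (M (b1 i) <= 1)%N 
  by move=> /genG/(b_sqfree i)[_ /sqfree].
have b0_le_b1 i M : G M -> (M (b0 i) <= M (b1 i))%N.
  move=> /genG GM; have [/sqfree + _] := b_sqfree i M GM.
  by have := b_dvd i M GM; rewrite !lep1mP; case: (M (b0 i)) => [|[]]// /(_ isT); lia.
pose f i : {mpoly k[n]} := 'X_(b0 i) + 'X_(b1 i).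
set xs := map _ _.
have size_xs : size xs = s by rewrite size_map size_enum_ord.
have mem_submod r p :
    submod_gen [set` take r xs]%classic (M := {ideal_quot (ideal_mul I I)})
      (\pi_{ideal_quot (ideal_mul I I)}%qT p)
    <-> mon_ideal (sums [set identify_mnm b0 b1 r M | M in G]%classic)
          (identify_mpoly b0 b1 r p).
  by rewrite submod_gen_quotient take_map_enum; exact: mem_ideal_square_pairs.
have f_reg (i : 'I_s) (q : {mpoly k[n]}) :
    let J := mon_ideal (sums [set identify_mnm b0 b1 i M | M in G]%classic) in
    J (f i * q) -> J q.
  apply: pair_sum_regular => // [l c d M N P GM GN GP Mc Nd Pcd|l r M lr GM le_M].
    by apply: (b_tri l); exists c, d; split; [exists M | exists N | exists P];
      rewrite ?genG //; exact: genG.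
  by apply: (b_apart l r lr); exists M => //; exact: genG.
have xs_reg : regular_sequence {ideal_quot (ideal_mul I I)} xs.
  split.
    move=> j; rewrite size_xs => js m; pose i := Ordinal js.
    have -> : xs`_j = f i.
      by rewrite (nth_map i) ?size_enum_ord // (nth_ord_enum i i).
    rewrite -[m]reprK.
    have -> : f i *: \pi_{ideal_quot (ideal_mul I I)}%qT (repr m) =
        \pi_{ideal_quot (ideal_mul I I)}%qT (f i * repr m) by rewrite rmorphM.
    rewrite !mem_submod rmorphM /=.
    have -> : identify_mpoly b0 b1 j (f i) = f i.
      rewrite rmorphD /= !identify_mpolyU /identify_sign !identify_id ?eqxx ?scale1r //.
        by move=> l _; rewrite eq_sym.
      move=> l lj; rewrite (inj_eq b0_inj).
      by apply: contraTneq lj => <-; rewrite ltnn.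
    exact: (f_reg i).
  (* 1 is outside: otherwise some generator would be the monomial 1, and I
     would not be proper. *)
  exists (\pi_{ideal_quot (ideal_mul I I)}%qT 1); rewrite -[xs](take_size xs).
  rewrite mem_submod rmorph1 -mpolyX0 mon_idealX.
  move=> [_ [_ [M GM <-] [_ [N _ <-] <-]] /mnm_lepP le0].
  suff M0 : M = 0%MM by case: GM; rewrite M0 mpolyX0 idealr1.
  apply/mnmP => x; have := le0 (identify b0 b1 (size xs) x).
  have := identify_mnm_ge b0 b1 (size xs) M x; rewrite mnmDE !mnm0E; lia.
split=> //; rewrite -[X in enat_le X]size_xs; apply: enat_le_depth => // _ /mapP[i _ ->].
have [_ _ idD] := is_ideal_gen (range (fun i : 'I_n => 'X_i : {mpoly k[n]})).
by apply: idD; apply: ideal_gen_incl; [exists (b0 i) | exists (b1 i)].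
Qed.
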